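(* Let $\mathbb K$ be a field of characteristic $0$ and let $(A,*,\{\,,\,,\,\},\alpha)$ be a Hom-Lie-Yamaguti algebra over $\mathbb K$. Suppose that its ternary operation is expressed through its binary one by $$\{x,y,z\} = (x*y)*\alpha(z) - (y*z)*\alpha(x) - (z*x)*\alpha(y)$$ for all $x,y,z\in A$. Then $(A,*,\alpha)$ is a multiplicative Hom-Malcev algebra.
   Context: All vector spaces and algebras are over a field $\mathbb K$ of characteristic $0$. The notation $\circlearrowleft_{(x,y,z)}$ means the sum over cyclic permutations of $x,y,z$. A Hom-algebra $(A,*,\alpha)$ is a $\mathbb K$-vector space $A$ with a bilinear operation $*:A\times A\to A$ and a linear map $\alpha:A\to A$. It is multiplicative if $\alpha(x*y)=\alpha(x)*\alpha(y)$ for all $x,y\in A$. The Hom-Jacobian is $J_\alpha(x,y,z)=\circlearrowleft_{(x,y,z)}(x*y)*\alpha(z)$. A Hom-Malcev algebra is a Hom-algebra $(A,*,\alpha)$ such that $*$ is anticommutative ($x*y=-y*x$) and the Hom-Malcev identity $$J_\alpha(\alpha(x),\alpha(y),x*z)=J_\alpha(x,y,z)*\alpha^2(x)$$ holds for all $x,y,z\in A$. A Hom-Lie-Yamaguti algebra (Hom-LYA) is a quadruple $(A,*,\{\,,\,,\,\},\alpha)$ in which $A$ is a $\mathbb K$-vector space, $*$ is a binary (bilinear) operation and $\{\,,\,,\,\}$ a ternary (trilinear) operation on $A$, and $\alpha:A\to A$ is a linear map, such that for all $u,v,w,x,y,z\in A$: (HLY1) $\alpha(x*y)=\alpha(x)*\alpha(y)$;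 (HLY2) $\alpha(\{x,y,z\})=\{\alpha(x),\alpha(y),\alpha(z)\}$; (HLY3) $x*y=-y*x$; (HLY4) $\{x,y,z\}=-\{y,x,z\}$; (HLY5) $\circlearrowleft_{(x,y,z)}[(x*y)*\alpha(z)+\{x,y,z\}]=0$; (HLY6) $\circlearrowleft_{(x,y,z)}\{x*y,\alpha(z),\alpha(u)\}=0$; (HLY7) $\{\alpha(x),\alpha(y),u*v\}=\{x,y,u\}*\alpha^2(v)+\alpha^2(u)*\{x,y,v\}$; (HLY8) $\{\alpha^2(x),\alpha^2(y),\{u,v,w\}\}=\{\{x,y,u\},\alpha^2(v),\alpha^2(w)\}+\{\alpha^2(u),\{x,y,v\},\alpha^2(w)\}+\{\alpha^2(u),\alpha^2(v),\{x,y,w\}\}$. *)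

(* Defs.v *)
From mathcomp Require Import all_boot all_algebra sesquilinear.
Set Implicit Arguments.
Unset Strict Implicit.
Unset Printing Implicit Defensive.

Import GRing.Theory.
Local Open Scope ring_scope.

Definition trilinear (K : fieldType) (A : lmodType K) (f : A -> A -> A -> A) :=
  [/\ forall y z, linear (fun x => f x y z),
      forall x z, linear (fun y => f x y z)
    & forall x y, linear (fun z => f x y z)].

Definition cyclic_sum (A : zmodType) (f : A -> A -> A -> A) (x y z : A) : A :=
  f x y z + f y z x + f z x y.

Definition hom_jacobian (A : zmodType) (mul : A -> A -> A) (alpha : A -> A)
    (x y z : A) : A :=
  cyclic_sum (fun x y z => mul (mul x y) (alpha z)) x y z.

Record hom_algebra (K : fieldType) (A : lmodType K)
    (mul : A -> A -> A) (alpha : A -> A) : Prop := HomAlgebra {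
  hom_mul_bilinear : bilinear_for *:%R *:%R mul;
  hom_alpha_linear : linear alpha
}.

Definition multiplicative_hom (A : Type) (mul : A -> A -> A) (alpha : A -> A) :=
  forall x y, alpha (mul x y) = mul (alpha x) (alpha y).

Record hom_malcev (K : fieldType) (A : lmodType K)
    (mul : A -> A -> A) (alpha : A -> A) : Prop := HomMalcev {
  malcev_hom_algebra : hom_algebra mul alpha;
  malcev_anticomm : forall x y, mul x y = - mul y x;
  malcev_identity : forall x y z,
    hom_jacobian mul alpha (alpha x) (alpha y) (mul x z)
      = mul (hom_jacobian mul alpha x y z) (alpha (alpha x))
}.

Record hom_lie_yamaguti (K : fieldType) (A : lmodType K)
    (mul : A -> A -> A) (tri : A -> A -> A -> A) (alpha : A -> A) : Prop :=
  HomLieYamaguti {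
  hly_hom_algebra : hom_algebra mul alpha;
  hly_trilinear : trilinear tri;
  hly1 : forall x y, alpha (mul x y) = mul (alpha x) (alpha y);
  hly2 : forall x y z, alpha (tri x y z) = tri (alpha x) (alpha y) (alpha z);
  hly3 : forall x y, mul x y = - mul y x;
  hly4 : forall x y z, tri x y z = - tri y x z;
  hly5 : forall x y z,
    cyclic_sum (fun x y z => mul (mul x y) (alpha z) + tri x y z) x y z = 0;
  hly6 : forall x y z u,
    cyclic_sum (fun x y z => tri (mul x y) (alpha z) (alpha u)) x y z = 0;
  hly7 : forall x y u v,
    tri (alpha x) (alpha y) (mul u v)
      = mul (tri x y u) (alpha (alpha v)) + mul (alpha (alpha u)) (tri x y v);
  hly8 : forall x y u v w,
    tri (alpha (alpha x)) (alpha (alpha y)) (tri u v w)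
      = tri (tri x y u) (alpha (alpha v)) (alpha (alpha w))
        + tri (alpha (alpha u)) (tri x y v) (alpha (alpha w))
        + tri (alpha (alpha u)) (alpha (alpha v)) (tri x y w)
}.

(* Main.v *)
(** Write [J] for the Hom-Jacobian.  The hypothesis on the ternary operation
    says [{x,y,z} = 2 (x*y)*alpha z - J(x,y,z)], and (HLY7) then becomes
      [J(alpha x, alpha y, u*v) = J(x,y,u)*alpha^2 v - J(x,y,v)*alpha^2 u
                                  - 2 J(x*y, alpha u, alpha v)].
    Put [P = J(x,y,z)*alpha^2 x], [Q = J(alpha x, alpha y, x*z)] and
    [R = J(alpha x, alpha z, x*y)].  Taking [u = x] and [v = z] gives
    [Q = - P - 2 R]; exchanging [y] and [z] gives [R = P - 2 Q].  Hence
    [3 Q = 3 P], which is the Hom-Malcev identity. *)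

Require Import Defs.
From mathcomp Require Import all_boot all_algebra.
Local Open Scope ring_scope.
Import GRing.Theory.

Lemma pchar0_mulrn_inj {K : fieldType} {A : lmodType K} (n : nat)
    (charK : [pchar K] =i pred0) (a b : A) :
  a *+ n.+1 = b *+ n.+1 -> a = b.
Proof.
move/pcharf0P in charK.
move/eqP; rewrite -subr_eq0 -mulrnBl -scaler_nat scaler_eq0.
by rewrite charK /= subr_eq0 => /eqP.
Qed.

Lemma hom_jacobian_rot {A : zmodType} (mul : A -> A -> A) (alpha : A -> A)
    (x y z : A) :
  hom_jacobian mul alpha y z x = hom_jacobian mul alpha x y z.
Proof. by rewrite /hom_jacobian /cyclic_sum addrC addrA. Qed.

Section HomAlgebra.

Context {K : fieldType} {A : lmodType K} {mul : A -> A -> A} {alpha : A -> A}.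
Hypothesis homA : hom_algebra mul alpha.

Local Notation J := (hom_jacobian mul alpha).

Lemma hom_mulDl (x y z : A) : mul (x + y) z = mul x z + mul y z.
Proof. by have /= := (hom_mul_bilinear homA).1 z 1 x y; rewrite !scale1r. Qed.

Lemma hom_mul0l (z : A) : mul 0 z = 0.
Proof. by apply: (addrI (mul 0 z)); rewrite -hom_mulDl !addr0. Qed.

Lemma hom_mulNl (x z : A) : mul (- x) z = - mul x z.
Proof. by apply/eqP; rewrite -addr_eq0 -hom_mulDl addNr hom_mul0l. Qed.

Hypothesis mulC : forall x y, mul x y = - mul y x.

Lemma hom_jacobian_swap (x y z : A) : J x z y = - J x y z.
Proof.
rewrite /hom_jacobian /cyclic_sum (mulC x z) (mulC z y) (mulC y x) !hom_mulNl.
by rewrite !opprD (AC 3 (3*2*1)).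
Qed.

(** A rotation makes the equal arguments adjacent; swapping them shows that [J] is its own negative,
    and 2 is invertible. This kills the [J(x,y,u)] term when [u = x]. *)
Lemma hom_jacobian_eq0 (charK : [pchar K] =i pred0) (x y : A) : J x y x = 0.
Proof.
apply: (pchar0_mulrn_inj 1 charK).
by rewrite mul0rn mulr2n -{1}hom_jacobian_rot hom_jacobian_swap hom_jacobian_rot
  -hom_jacobian_rot addNr.
Qed.

End HomAlgebra.

Lemma hly_jacobian_mul {K : fieldType} {A : lmodType K} {mul : A -> A -> A}
    {tri : A -> A -> A -> A} {alpha : A -> A}
    (lyaA : hom_lie_yamaguti mul tri alpha)
    (triE : forall x y z : A,
      tri x y z = mul (mul x y) (alpha z) - mul (mul y z) (alpha x)
                  - mul (mul z x) (alpha y)) (x y u v : A) :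
  hom_jacobian mul alpha (alpha x) (alpha y) (mul u v)
    = mul (hom_jacobian mul alpha x y u) (alpha (alpha v))
      - mul (hom_jacobian mul alpha x y v) (alpha (alpha u))
      - hom_jacobian mul alpha (mul x y) (alpha u) (alpha v) *+ 2.
Proof.
have homA := hly_hom_algebra lyaA; have mulC := hly3 lyaA.
have alphaM := hly1 lyaA.
have triJ a b c :
    tri a b c = mul (mul a b) (alpha c) *+ 2 - hom_jacobian mul alpha a b c.
  by rewrite triE /hom_jacobian /cyclic_sum mulr2n !opprD !addrA addrK.
have := hly7 lyaA x y u v; rewrite !triJ.
(* These three Jacobians stay atoms; only [J(x*y, alpha u, alpha v)] gets expanded. *)
set Q := hom_jacobian _ _ (alpha x) _ _; clearbody Q.
set Ju := hom_jacobian _ _ x y u; clearbody Ju.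
set Jv := hom_jacobian _ _ x y v; clearbody Jv.
rewrite (mulC (alpha (alpha u))) !mulr2n !(hom_mulDl homA) !(hom_mulNl homA).
rewrite /hom_jacobian /cyclic_sum -(alphaM x) -(alphaM u).
rewrite (mulC (alpha v)) (hom_mulNl homA) (mulC (alpha (mul u v))).
(* By anticommutativity [J(x*y, alpha u, alpha v)] is [a - b - c], which collects the doubled
   products of (HLY7). *)
set a := mul (mul (mul x y) (alpha u)) _.
set b := mul (mul (mul x y) (alpha v)) _.
set c := mul (alpha (mul x y)) _.
move=> HLY7; rewrite -[Q in LHS](subKr (c + c)) HLY7 !opprD !opprK !addrA.
by rewrite (ACl (5*8*3*1*6*4*2*7)).
Qed.

Theorem theorem1p1 (K : fieldType) (charK : [pchar K] =i pred0)
    (A : lmodType K) (mul : A -> A -> A) (tri : A -> A -> A -> A)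
    (alpha : A -> A)
    (lyaA : hom_lie_yamaguti mul tri alpha)
    (triE : forall x y z : A,
      tri x y z = mul (mul x y) (alpha z) - mul (mul y z) (alpha x)
                  - mul (mul z x) (alpha y)) :
  multiplicative_hom mul alpha /\ hom_malcev mul alpha.
Proof.
have homA := hly_hom_algebra lyaA; have mulC := hly3 lyaA.
split; first exact: hly1 lyaA.
split=> // x y z.
have := hly_jacobian_mul lyaA triE x z x y.
have := hly_jacobian_mul lyaA triE x y x z.
rewrite !(hom_jacobian_eq0 homA mulC charK) !(hom_mul0l homA) !sub0r.
rewrite (hom_jacobian_swap homA mulC x y z) (hom_mulNl homA) opprK.
(* With the product in the first slot, the left side of each identity is the doubled term of the
   other. *)
rewrite !(hom_jacobian_rot mul alpha (mul _ _)).
set P := mul (hom_jacobian _ _ x y z) _.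
set Q := hom_jacobian _ _ (mul x z) _ _.
move=> QE RE; apply: (pchar0_mulrn_inj 2 charK).
(* Eliminating [R] gives [Q = 4Q - 3P], so [Q] is added to both sides of [3Q = 3P] and rewritten on
   the right only. *)
apply: (addrI Q); rewrite -mulrS [in RHS]QE RE mulrnBl -mulrnA opprB.
by rewrite addrC (mulrS P) addrACA subrr add0r addrC subrK.
Qed.
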